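(* Let $m\le n$ be positive integers and let $A$ be an $m\times n$ matrix with nonnegative real entries and maximum entry $\alpha$. Then $$\mathcal{E}(A)\le \alpha\,\frac{(m+\sqrt{m})\sqrt{n}}{2}.$$
   Context: For a complex $m\times n$ matrix $A$, $A^{*}$ denotes its Hermitian adjoint (conjugate transpose). The singular values $\sigma_1(A)\ge\sigma_2(A)\ge\dots$ of $A$ are the square roots of the eigenvalues of $AA^{*}$ (counted with multiplicity). The energy of $A$ is $\mathcal{E}(A)=\sigma_1(A)+\sigma_2(A)+\cdots$, the sum of all singular values of $A$. *)

(* Defs.v *)
From mathcomp Require Import all_boot all_order all_algebra.
From mathcomp Require Import complex reals.

Set Implicit Arguments.
Unset Strict Implicit.
Unset Printing Implicit Defensive.

Import Order.TTheory GRing.Theory Num.Theory.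
Local Open Scope ring_scope.
Local Open Scope sesquilinear_scope.

(* The eigenvalues of M listed with algebraic multiplicity, as roots of the
   characteristic polynomial; for M = A A^* , which is diagonalizable, this is
   also the geometric multiplicity. *)
Definition eigenvalues (C : numClosedFieldType) (n : nat) (M : 'M[C]_n) :
    seq C :=
  sval (closed_field_poly_normal (char_poly M)).

Lemma eigenvaluesP (C : numClosedFieldType) (n : nat) (M : 'M[C]_n) :
  char_poly M = \prod_(z <- eigenvalues M) ('X - z%:P).
Proof.
rewrite /eigenvalues; case: closed_field_poly_normal => r /= {1}->.
by rewrite (monicP (char_poly_monic M)) scale1r.
Qed.

(* The order of C is partial (x <= y iff y - x is a nonnegative real), but the
   eigenvalues of A A^* and hence their square roots are nonnegative reals, on
   which it is total. *)
Definition singular_values (C : numClosedFieldType) (m n : nat)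
    (A : 'M[C]_(m, n)) : seq C :=
  sort >=%R [seq sqrtC z | z <- eigenvalues (A *m A ^t*)].

Definition energy (C : numClosedFieldType) (m n : nat) (A : 'M[C]_(m, n)) : C :=
  \sum_(s <- singular_values A) s.

Definition is_max_entry (R : realType) (m n : nat) (A : 'M[R]_(m, n))
    (alpha : R) : Prop :=
  (exists i j, A i j = alpha) /\ (forall i j, A i j <= alpha).

(* Main.v *)
Require Import Defs.
From mathcomp Require Import all_boot all_order all_algebra.
From mathcomp Require Import complex reals.

(** Write [alpha] for the largest entry and [J] for the all-ones matrix.  The
    energy is the nuclear norm, hence subadditive, so halving the identity
    [2 A = (2 A - alpha J) + alpha J] bounds the energy of [A] by half the sum
    of the energies of [B = 2 A - alpha J] and of [alpha J].  Because
    [0 <= A i j <= alpha], the entries of [B] lie in [[-alpha, alpha]], so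
    each of its [m] rows has norm at most [alpha * sqrt n] and its energy is
    at most [alpha * m * sqrt n].  The matrix [alpha J] has rank one and energy
    [alpha * sqrt (m * n)].  The half sum is the stated bound.

    Subadditivity is only needed in its dual form [energy_dual]: the energy of
    [A] is the Frobenius inner product of [A] with a contraction [W], which for
    a singular value decomposition [A = P^* S Q] is the partial isometry with
    the same singular vectors.  Pairing [W] with [B] and with [alpha J], and
    applying Cauchy-Schwarz to each, gives the two bounds of the sum.  To
    construct [W], the Gram matrix [A A^*] is diagonalized by a unitary [P]
    ([gram_diagonalization]); the rows of [P A] are then orthogonal with the
    singular values as norms ([energy_diagonalization]), and normalizing the
    nonzero ones gives [P W]. *)

Import Order.TTheory GRing.Theory Num.Theory.
Local Open Scope ring_scope.
Local Open Scope complex_scope.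
Local Open Scope sesquilinear_scope.

Lemma trmxC_mul (C : numClosedFieldType) (m n p : nat)
    (A : 'M[C]_(m, n)) (B : 'M[C]_(n, p)) :
  (A *m B)^t* = B^t* *m A^t*.
Proof. by rewrite trmx_mul map_mxM. Qed.

Lemma dotmx_sqnorm (C : numClosedFieldType) (n : nat) (u : 'rV[C]_n) :
  dotmx u u = \sum_j `|u 0 j| ^+ 2.
Proof.
by rewrite dotmxE mxE; apply: eq_bigr => j _; rewrite !mxE normCK.
Qed.

Lemma norm_dotmx_le (C : numClosedFieldType) (n : nat) (u v : 'rV[C]_n)
    (a b : C) :
    0 <= a -> 0 <= b -> dotmx u u <= a ^+ 2 -> dotmx v v <= b ^+ 2 ->
  `|dotmx u v| <= a * b.
Proof.
move=> a0 b0 ua vb; apply: le_trans (CauchySchwarz_sqrt (@dotmx C n) u v).1 _.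
apply: ler_pM; rewrite ?sqrtC_ge0 ?dnorm_ge0 //.
  by rewrite -(sqrCK a0) ler_sqrtC ?nnegrE ?dnorm_ge0 ?exprn_ge0.
by rewrite -(sqrCK b0) ler_sqrtC ?nnegrE ?dnorm_ge0 ?exprn_ge0.
Qed.

Lemma char_poly_similar (R : comUnitRingType) (n : nat) (P B : 'M[R]_n) :
  P \in unitmx -> char_poly (invmx P *m B *m P) = char_poly B.
Proof.
move=> Pu; rewrite /char_poly /char_poly_mx.
set Q := map_mx polyC P.
have Qu : map_mx polyC (invmx P) *m Q = 1%:M by rewrite -map_mxM mulVmx ?map_mx1.
have -> : 'X%:M - map_mx polyC (invmx P *m B *m P) =
    map_mx polyC (invmx P) *m ('X%:M - map_mx polyC B) *m Q.
  rewrite mulmxBr mulmxBl scalar_mxC -(mulmxA _ _ Q) Qu mulmx1.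
  by rewrite !map_mxM.
by rewrite !det_mulmx mulrAC -det_mulmx Qu det1 mul1r.
Qed.

(** In a singular value decomposition [A = P^* S Q] one has [P A = S Q], whose
    rows are orthogonal with the singular values as norms: [d] lists the squared
    singular values. *)
Lemma gram_diagonalization (C : numClosedFieldType) (m n : nat)
    (A : 'M[C]_(m, n)) :
  exists P : 'M[C]_m, exists2 d : 'rV[C]_m,
    P \is unitarymx /\ (forall i, 0 <= d 0 i)
  & (P *m A) *m (P *m A)^t* = diag_mx d.
Proof.
have /orthomx_spectralP : A *m A^t* \is normalmx.
  by apply/normalmxP; rewrite trmxC_mul trmxCK.
set P := spectralmx _; set d := spectral_diag _ => AA.
have Pun : P \is unitarymx by apply: spectral_unitarymx.
have VV : (P *m A) *m (P *m A)^t* = diag_mx d.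
  rewrite trmxC_mul mulmxA -(mulmxA P) AA invmx_unitary // !mulmxA.
  by rewrite mulmxtVK // (unitarymxP Pun) mul1mx.
exists P, d => //; split=> // i.
have /matrixP/(_ i i) := VV; rewrite !mxE eqxx mulr1n => <-.
by apply: sumr_ge0 => j _; rewrite !mxE mul_conjC_ge0.
Qed.

(** [A A^*] is similar to [diag_mx d], so both have the same characteristic
    polynomial, whose factorization determines the multiset of eigenvalues. *)
Lemma energy_diagonalization (C : numClosedFieldType) (m n : nat)
    (A : 'M[C]_(m, n)) (P : 'M[C]_m) (d : 'rV[C]_m) :
    P \is unitarymx -> (P *m A) *m (P *m A)^t* = diag_mx d ->
  energy A = \sum_i sqrtC (d 0 i).
Proof.
move=> Pun VV; rewrite /energy /singular_values.
set sv := [seq _ | z <- _].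
have -> : \sum_(s <- sort >=%R sv) s = \sum_(s <- sv) s.
  by apply: perm_big; rewrite perm_sort.
rewrite big_map.
have AA : A *m A^t* = invmx P *m diag_mx d *m P.
  by rewrite -VV trmxC_mul -!mulmxA mulKmx ?unitarymx_unit // !mulmxA mulmxKtV.
have eig_d : perm_eq (eigenvalues (A *m A^t*)) [seq d 0 i | i <- enum 'I_m].
  apply: prod_XsubC_eq.
  rewrite -eigenvaluesP AA char_poly_similar ?unitarymx_unit //.
  rewrite char_poly_trig ?diag_mx_is_trig // big_map big_enum /=.
  by apply: eq_bigr => i _; rewrite mxE eqxx mulr1n.
by rewrite (perm_big _ eig_d) big_map big_enum.
Qed.

Lemma energy_ge0 (C : numClosedFieldType) (m n : nat) (A : 'M[C]_(m, n)) :
  0 <= energy A.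
Proof.
have [P [d [Pun d0] VV]] := gram_diagonalization _ _ _ A.
rewrite (energy_diagonalization _ _ _ _ _ _ Pun VV).
by apply: sumr_ge0 => i _; rewrite sqrtC_ge0.
Qed.

(** One half of the duality between the nuclear and the operator norm: the
    supremum of the pairings of [A] with contractions is attained at the energy.
    The contraction acts on row vectors, so that it bounds the norm of each row
    of [W] by 1. *)
Lemma energy_dual (C : numClosedFieldType) (m n : nat) (A : 'M[C]_(m, n)) :
  exists2 W : 'M[C]_(m, n),
    forall u : 'rV[C]_m, dotmx (u *m W) (u *m W) <= dotmx u u
  & energy A = \sum_i dotmx (row i A) (row i W).
Proof.
have [P [d [Pun d0] VV]] := gram_diagonalization _ _ _ A.
have PtP : P^t* *m P = 1%:M.
  by rewrite -invmx_unitary // mulVmx ?unitarymx_unit.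
(* A zero singular value gets weight [0^-1 = 0] and so drops out below. *)
pose r : 'rV[C]_m := \row_i (sqrtC (d 0 i))^-1.
have rC : (diag_mx r)^t* = diag_mx r.
  rewrite tr_diag_mx map_diag_mx; congr diag_mx; apply/rowP => i; rewrite !mxE.
  by apply/CrealP; rewrite ger0_real // invr_ge0 sqrtC_ge0.
set V := P *m A in VV *.
(* The right-hand side is the projection on the nonzero singular values. *)
have UU : (diag_mx r *m V) *m (diag_mx r *m V)^t* =
    diag_mx (\row_i (r 0 i * d 0 i * r 0 i)).
  rewrite trmxC_mul rC mulmxA -(mulmxA _ V) VV !mulmx_diag.
  by congr diag_mx; apply/rowP => i; rewrite !mxE.
exists (P^t* *m (diag_mx r *m V)) => [u|].
  rewrite mulmxA; set v := u *m P^t*.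
  have -> : dotmx u u = dotmx v v.
    rewrite !dotmxE /v trmxC_mul trmxCK -mulmxA (mulmxA _ P).
    by rewrite PtP mul1mx.
  rewrite !dotmxE trmxC_mul mulmxA -(mulmxA v) UU mxE [leRHS]mxE.
  apply: ler_sum => i _.
  rewrite mul_mx_diag !mxE.
  set s := sqrtC (d 0 i).
  have dE : d 0 i = s * s by rewrite -expr2 sqrtCK.
  have [s0|s0] := eqVneq s 0.
    by rewrite s0 dE s0 !(mul0r, mulr0, invr0) mul_conjC_ge0.
  by rewrite dE mulKf // mulfV // mulr1.
rewrite (energy_diagonalization _ _ _ _ _ _ Pun VV).
have -> : \sum_i dotmx (row i A) (row i (P^t* *m (diag_mx r *m V))) =
  \tr (A *m (P^t* *m (diag_mx r *m V))^t*).
  apply: eq_bigr => i _; rewrite dotmxE !mxE; apply: eq_bigr => j _.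
  by rewrite !mxE.
rewrite trmxC_mul trmxCK (trmxC_mul _ _ _ _ (diag_mx r)) rC.
rewrite mulmxA mxtrace_mulC !mulmxA -/V VV mulmx_diag mxtrace_diag.
apply: eq_bigr => i _; rewrite !mxE.
have [->|s0] := eqVneq (d 0 i) 0; first by rewrite sqrtC0 mul0r.
by rewrite -{2}(sqrtCK (d 0 i)) expr2 mulfK // sqrtC_eq0.
Qed.

(** Centring the entries at [a / 2] halves their size at the cost of a rank-one
    term: this is where nonnegativity improves the bound [a * m * sqrt n] that
    holds for arbitrary entries of modulus at most [a]. *)
Lemma energy_nonneg_le (C : numClosedFieldType) (m n : nat)
    (A : 'M[C]_(m, n)) (a : C) :
    0 <= a -> (forall i j, 0 <= A i j <= a) ->
  energy A *+ 2 <= a * (m%:R + sqrtC m%:R) * sqrtC n%:R.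
Proof.
move=> a0 Aa; have [W Wle EA] := energy_dual _ _ _ A.
pose B := A *+ 2 - const_mx a.
pose J : 'rV[C]_n := const_mx 1.
have sqJ k : dotmx (const_mx 1 : 'rV[C]_k) (const_mx 1) <= sqrtC k%:R ^+ 2.
  rewrite sqrtCK dotmx_sqnorm (eq_bigr (fun=> 1)) ?sumr_const ?card_ord //.
  by move=> j _; rewrite mxE normr1 expr1n.
have rowW i : dotmx (row i W) (row i W) <= 1 ^+ 2.
  rewrite rowE; apply: le_trans (Wle _) _.
  by rewrite dotmxE trmx_delta map_delta_mx mul_delta_mx mxE !eqxx expr1n.
have rowB i : dotmx (row i B) (row i B) <= (a * sqrtC n%:R) ^+ 2.
  rewrite dotmx_sqnorm exprMn sqrtCK mulr_natr -[n in leRHS]card_ord -sumr_const.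
  apply: ler_sum => j _; rewrite !mxE; have /andP[A0 A1] := Aa i j.
  rewrite ler_pXn2r ?nnegrE // real_ler_norml; last first.
    by rewrite realB ?realD ?ger0_real.
  by rewrite lerBrDr addNr addr_ge0 //= lerBlDr lerD.
(* The pairing of [a J] with [W] depends only on the sum of the rows of [W],
   which is the image of the all-ones vector. *)
have EW : energy A *+ 2 =
   \sum_i dotmx (row i B) (row i W) + a * dotmx J (const_mx 1 *m W).
  rewrite mulmx_sum_row [dotmx J _]raddf_sum mulr_sumr -big_split EA -sumrMnl.
  apply: eq_bigr => i _ /=; rewrite mxE scale1r -linearZl_LR -linearDl /=.
  rewrite mulr2n -linearDl /=; congr dotmx; apply/rowP => j.
  by rewrite !mxE mulr1 subrK.
rewrite -[leLHS]ger0_norm ?mulrn_wge0 ?energy_ge0 // EW.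
apply: le_trans (ler_normD _ _) _; rewrite mulrDr mulrDl.
apply: lerD.
  apply: le_trans (ler_norm_sum _ _ _) _.
  rewrite mulrAC mulr_natr -[m in leRHS]card_ord -sumr_const.
  apply: ler_sum => i _; rewrite -[leRHS]mulr1.
  by apply: norm_dotmx_le; rewrite ?mulr_ge0 ?sqrtC_ge0 ?ler0n.
rewrite normrM ger0_norm // -mulrA ler_wpM2l // mulrC.
apply: norm_dotmx_le; rewrite ?sqrtC_ge0 ?ler0n //.
exact: le_trans (Wle _) (sqJ _).
Qed.

Theorem theorem2 (R : realType) (m n : nat) (A : 'M[R]_(m, n)) (alpha : R)
    (m_gt0 : (0 < m)%N) (le_mn : (m <= n)%N)
    (A_ge0 : forall i j, 0 <= A i j) (A_max : is_max_entry A alpha) :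
  energy (map_mx (real_complex R) A) <=
    (alpha * ((m%:R + Num.sqrt m%:R) * Num.sqrt n%:R / 2))%:C.
Proof.
have alpha0 : 0 <= alpha.
  by case: A_max => -[i [j <-]] _; apply: A_ge0.
set AC := map_mx _ A.
have sqrtR k : sqrtC k%:R = (Num.sqrt k%:R : R)%:C.
  have s0 : 0 <= (Num.sqrt k%:R : R)%:C by rewrite ler0c sqrtr_ge0.
  by rewrite -[RHS]sqrCK // -rmorphXn /= sqr_sqrtr ?ler0n // rmorph_nat.
have /energy_nonneg_le : 0 <= alpha%:C by rewrite ler0c.
move/(_ _ _ AC); rewrite !sqrtR => bound.
rewrite mulrA rmorphM fmorphV /= rmorph_nat ler_pdivlMr ?ltr0n // mulr_natr.
rewrite mulrA !(rmorphM, rmorphD) /= rmorph_nat.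
by apply: bound => i j; rewrite mxE ler0c lecR A_ge0 A_max.2.
Qed.
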